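(* Let $(\mathfrak{g},[-,-]_{\mathfrak{g}},P)$ and $(\mathfrak{g}^{*},[-,-]_{\mathfrak{g}^{*}},Q^{*})$ be Rota-Baxter Lie algebras of weight zero (with $P,Q:\mathfrak g\to\mathfrak g$ linear) such that $Q$ is admissible to $(\mathfrak{g},[-,-]_{\mathfrak{g}},P)$ and $P^{*}$ is admissible to $(\mathfrak{g}^{*},[-,-]_{\mathfrak{g}^{*}},Q^{*})$. Let $x\circ_{\mathfrak g}y=[P(x),y]_{\mathfrak g}$ and $a^*\circ_{\mathfrak g^*}b^*=[Q^*(a^* ),b^*]_{\mathfrak g^*}$ be the induced pre-Lie algebra structures, and let $(\mathfrak{g},\triangleright_{\mathfrak{g}},\triangleleft_{\mathfrak{g}})$ and $(\mathfrak{g}^{*},\triangleright_{\mathfrak{g}^{*}},\triangleleft_{\mathfrak{g}^{*}})$ be the compatible special L-dendriform algebras given by $$x\triangleleft_{\mathfrak{g}}y=-Q([x,y]_{\mathfrak{g}}),\quad x\triangleright_{\mathfrak{g}} y=x\circ_{\mathfrak{g}}y-x\triangleleft_{\mathfrak{g}}y,\quad a^{*}\triangleleft_{\mathfrak{g}^{*}}b^{*}=-P^{*}([a^{*}, b^{*}]_{\mathfrak{g}^{*}}), \quad a^{*}\triangleright_{\mathfrak{g}^{*}}b^{*}=a^{*}\circ_{\mathfrak{g}^{*}}b^{*}-a^{*}\triangleleft_{\mathfrak{g}^{*}}b^{*}.$$ Let $\delta,\Delta,\nabla:\mathfrak{g}\rightarrow \mathfrak{g}\otimes\mathfrak{g}$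 be the linear duals of $[-,-]_{\mathfrak{g}^{*}}$, $\triangleright_{\mathfrak{g}^{*}}$ and $\triangleleft_{\mathfrak{g}^{*}}$ respectively. Then $(\mathfrak{g},\triangleright_{\mathfrak{g}},\triangleleft_{\mathfrak{g}},\Delta,\nabla)$ is a special L-dendriform bialgebra if and only if the following equations hold for all $x,y\in\mathfrak g$: $$(Q\otimes\mathrm{id})\Big(\delta([P(x),y]_{\mathfrak{g}})+(\mathrm{id}\otimes\mathrm{ad}_{\mathfrak{g}}(y)+\mathrm{ad}_{\mathfrak{g}}(y)\otimes\mathrm{id})\delta(P(x))-(\mathrm{id}\otimes\mathrm{ad}_{\mathfrak{g}}(P(x))+\mathrm{ad}_{\mathfrak{g}}(P(x))\otimes\mathrm{id})\delta(y)\Big)=0,$$ $$(Q\otimes Q)\Big(\delta([x,y]_{\mathfrak{g}})+(\mathrm{id}\otimes\mathrm{ad}_{\mathfrak{g}}(y)+\mathrm{ad}_{\mathfrak{g}}(y)\otimes\mathrm{id})\delta(x)-(\mathrm{id}\otimes\mathrm{ad}_{\mathfrak{g}}(x)+\mathrm{ad}_{\mathfrak{g}}(x)\otimes\mathrm{id})\delta(y)\Big)=0,$$ $$\delta([P(x),P(y)]_{\mathfrak{g}})=(\mathrm{id}\otimes\mathrm{ad}_{\mathfrak{g}}(P(x))+\mathrm{ad}_{\mathfrak{g}}(P(x))\otimes\mathrm{id})\delta(P(y))-(\mathrm{id}\otimes\mathrm{ad}_{\mathfrak{g}}(P(y))+\mathrm{ad}_{\mathfrak{g}}(P(y))\otimes\mathrm{id})\delta(P(x)).$$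 In particular, if $(\mathfrak{g},[-,-]_{\mathfrak{g}},P,\delta,Q)$ is a Rota-Baxter Lie bialgebra of weight zero, then $(\mathfrak{g},\triangleright_{\mathfrak{g}},\triangleleft_{\mathfrak{g}},\Delta,\nabla)$ is a special L-dendriform bialgebra.
   Context: All vector spaces and algebras are finite-dimensional over a field of characteristic zero. $T^*$ denotes the transpose of a linear map $T$, $\tau$ is the flip on tensor squares, and $\mathrm{ad}_{\mathfrak g}(x)y=[x,y]_{\mathfrak g}$. The linear dual of an operation $\cdot$ on $A^*$ is the map $\theta:A\to A\otimes A$ with $\langle\theta(x),a^*\otimes b^*\rangle=\langle x,a^*\cdot b^*\rangle$. A Rota-Baxter Lie algebra of weight zero is $(\mathfrak{g},[-,-],P)$ with $[P(x),P(y)]=P([x,P(y)])+P([P(x),y])$. A linear map $Q:\mathfrak g\to\mathfrak g$ is admissible to it if $Q([P(x),y])-[P(x),Q(y)]-Q([x,Q(y)])=0$ for all $x,y$. A pre-Lie algebra is $(A,\circ)$ with $(x\circ y)\circ z-x\circ(y\circ z)=(y\circ x)\circ z-y\circ(x\circ z)$. An L-dendriform algebra $(A,\triangleright,\triangleleft)$ is a vector space with two bilinear operations satisfying, for all $x,y,z$, $(x\triangleright y)\triangleright z+(x\triangleleft y)\triangleright z+y\triangleright(x\triangleright z)-(y\triangleleft x)\triangleright z-(y\triangleright x)\triangleright z-x\triangleright(y\triangleright z)=0$ and $(x\triangleright y)\triangleleft z+y\triangleleft(x\triangleright z)+y\triangleleft(x\triangleleft z)-(y\triangleleft x)\triangleleft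 z-x\triangleright(y\triangleleft z)=0$. It is special if $\triangleleft$ is antisymmetric; then $x\circ y=x\triangleright y+x\triangleleft y$ is a pre-Lie product (the sub-adjacent pre-Lie algebra), and $(A,\triangleright,\triangleleft)$ is called compatible with $(A,\circ)$. (Under the hypotheses of the statement, the given operations on $\mathfrak{g}$ and $\mathfrak{g}^*$ are indeed special L-dendriform.) A special L-dendriform coalgebra is $(A,\Delta,\nabla)$ with linear maps $\Delta,\nabla:A\to A\otimes A$, $\nabla$ co-antisymmetric ($\nabla=-\tau\nabla$), such that with $\Diamond=\Delta+\nabla$: $(\mathrm{id}\otimes\nabla)\nabla+(\tau\otimes\mathrm{id})(\mathrm{id}\otimes\Diamond)\nabla+(\Diamond\otimes\mathrm{id})\nabla-(\mathrm{id}\otimes\nabla)\Diamond=0$, $(\Diamond\otimes\mathrm{id})\Diamond-(\mathrm{id}\otimes\Diamond)\Diamond=(\tau\otimes\mathrm{id})(\Diamond\otimes\mathrm{id})\Diamond-(\tau\otimes\mathrm{id})(\mathrm{id}\otimes\Diamond)\Diamond$. A special L-dendriform bialgebra $(A,\triangleright,\triangleleft,\Delta,\nabla)$ consists of a special L-dendriform algebra $(A,\triangleright,\triangleleft)$ and a special L-dendriform coalgebra $(A,\Delta,\nabla)$ such that, with $\Diamond=\Delta+\nabla$, $x\circ y=x\triangleright y+x\triangleleft y$, $[x,y]=x\circ y-y\circ x$, $\mathcal{L}_{\cdot}(x)y=x\cdot y$, $\mathcal{R}_{\cdot}(y)x=x\cdot y$, for all $x,y\in A$: $\Diamond(x\circ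 y)-(\mathrm{id}\otimes\mathcal{R}_{\circ}(y))\Delta(x)+(\mathcal{L}_{\triangleleft}(y)\otimes\mathrm{id})\nabla(x)-(\mathcal{L}_{\triangleright}(x)\otimes\mathrm{id}+\mathrm{id}\otimes\mathcal{L}_{\circ}(x))\Diamond(y)=0$, $(\tau-\mathrm{id})\big((\mathrm{id}\otimes\mathcal{L}_{\triangleleft}(x))\Diamond(y)-(\mathrm{id}\otimes\mathcal{L}_{\triangleleft}(y))\Diamond(x)-\Diamond(x\triangleleft y)\big)=0$, $\nabla([x,y])+(\mathcal{L}_{\circ}(y)\otimes\mathrm{id}+\mathrm{id}\otimes\mathcal{L}_{\circ}(y))\nabla(x)-(\mathcal{L}_{\circ}(x)\otimes\mathrm{id}+\mathrm{id}\otimes\mathcal{L}_{\circ}(x))\nabla(y)=0$. A Rota-Baxter Lie bialgebra of weight zero is $(\mathfrak{g},[-,-],P,\delta,Q)$ such that $(\mathfrak{g},[-,-],\delta)$ is a Lie bialgebra (Lie algebra and Lie coalgebra with $\delta([x,y])=(\mathrm{ad}(x)\otimes \mathrm{id}+\mathrm{id}\otimes\mathrm{ad}(x))\delta(y)-(\mathrm{ad}(y)\otimes \mathrm{id}+\mathrm{id}\otimes\mathrm{ad}(y))\delta(x)$), $(\mathfrak{g},[-,-],P)$ is a Rota-Baxter Lie algebra of weight zero, $(Q\otimes Q)\delta(x)=(Q\otimes\mathrm{id}+\mathrm{id}\otimes Q)\delta(Q(x))$ for all $x$, $Q$ is admissible to $(\mathfrak{g},[-,-],P)$, and $(P\otimes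 Q)\delta(x)+(P\otimes\mathrm{id}-\mathrm{id}\otimes Q)\delta(P(x))=0$ for all $x$ (equivalently, $P^*$ is admissible to $(\mathfrak{g}^*,\delta^*,Q^* )$). *)

(* Defs.v *)
From HB Require Import structures.
From mathcomp Require Import all_boot all_order all_algebra.

Set Implicit Arguments.
Unset Strict Implicit.
Unset Printing Implicit Defensive.

Import GRing.Theory.
Local Open Scope ring_scope.

Section LinearMaps.

Variable F : fieldType.
Implicit Types U V W : vectType F.

Lemma linfunP U V (f : U -> V) : linear f -> linfun f =1 f.
Proof.
move=> lf; pose fL := GRing.isLinear.Build F U V *:%R f lf.
exact: (lfunE (HB.pack f fL : {linear U -> V})).
Qed.

(* [linfun] and [lfun2] are meaningful on maps that are linear in each
   argument, see [linfunP] and [lfun2E]; they are only used on such maps. *)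
Definition lfun2 U V W (f : U -> V -> W) : 'Hom(U, 'Hom(V, W)) :=
  linfun (fun u => linfun (f u)).

Lemma lfun2E U V W (f : U -> V -> W) :
  (forall u, linear (f u)) -> (forall v, linear (f^~ v)) ->
  forall u v, lfun2 f u v = f u v.
Proof.
move=> fr fl u v; rewrite /lfun2 linfunP ?linfunP // => a x y.
by apply/lfunP=> w; rewrite add_lfunE scale_lfunE !linfunP // fl.
Qed.

Definition binop V := 'Hom(V, 'Hom(V, V)).

Definition dual V : vectType F := 'Hom(V, F^o).

Definition transpose U V (T : 'Hom(U, V)) : 'Hom(dual V, dual U) :=
  linfun (fun f : dual V => (f \o T)%VF : dual U).

Lemma transposeE U V (T : 'Hom(U, V)) (f : dual V) (u : U) :
  transpose T f u = f (T u).
Proof.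
rewrite /transpose linfunP ?comp_lfunE // => a x y.
by rewrite comp_lfunDl comp_lfunZl.
Qed.

Definition rmul V (op : binop V) (y : V) : 'End(V) := linfun (op^~ y).

Lemma rmulE V (op : binop V) x y : rmul op y x = op x y.
Proof.
rewrite /rmul linfunP // => a u v.
by rewrite linearP add_lfunE scale_lfunE.
Qed.

(* In finite dimension, U (x) V = Hom(U^*, V), where u (x) v is the map
   f |-> f(u) v. Lemmas [tliftE] and [tensor_ext] give the universal property;
   all maps out of a tensor product below are defined with [tlift]. *)
Definition tensor U V : vectType F := 'Hom(dual U, V).

Definition ptens U V (u : U) (v : V) : tensor U V :=
  linfun (fun f : dual U => (f u : F) *: v).

Lemma ptensE U V (u : U) (v : V) (f : dual U) : ptens u v f = (f u : F) *: v.
Proof.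
rewrite /ptens linfunP // => a x y.
by rewrite add_lfunE scale_lfunE scalerDl scalerA.
Qed.

Lemma ptens_linearr U V (u : U) : linear (@ptens U V u).
Proof.
move=> a x y; apply/lfunP=> f.
by rewrite add_lfunE scale_lfunE !ptensE scalerDr !scalerA mulrC.
Qed.

Lemma ptens_linearl U V (v : V) : linear ((@ptens U V)^~ v).
Proof.
move=> a x y; apply/lfunP=> f.
by rewrite add_lfunE scale_lfunE !ptensE linearP scalerDl !scalerA.
Qed.

Definition cofun U (i : 'I_(\dim {:U})) : dual U :=
  linfun (coord (vbasis {:U}) i : U -> F^o).

Definition tlift U V W (b : 'Hom(U, 'Hom(V, W))) : 'Hom(tensor U V, W) :=
  linfun (fun t : tensor U V =>
    \sum_(i < \dim {:U}) b (vbasis {:U})`_i (t (cofun i))).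

Lemma tliftE U V W (b : 'Hom(U, 'Hom(V, W))) u v : tlift b (ptens u v) = b u v.
Proof.
rewrite /tlift linfunP; last first.
  move=> a x y; rewrite scaler_sumr -big_split /=; apply: eq_bigr => i _.
  by rewrite add_lfunE scale_lfunE linearP.
rewrite [in RHS](coord_vbasis (memvf u)) linear_sum sum_lfunE.
apply: eq_bigr => i _.
by rewrite ptensE lfunE linearZ linearZ scale_lfunE.
Qed.

Lemma dual_sum U (f : dual U) :
  f = \sum_(i < \dim {:U}) (f (vbasis {:U})`_i : F) *: cofun i.
Proof.
apply/lfunP=> u; rewrite sum_lfunE {1}(coord_vbasis (memvf u)) linear_sum.
apply: eq_bigr => i _; rewrite linearZ scale_lfunE lfunE; exact: mulrC.
Qed.

Lemma tensor_sum U V (t : tensor U V) :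
  t = \sum_(i < \dim {:U}) ptens (vbasis {:U})`_i (t (cofun i)).
Proof.
apply/lfunP=> f; rewrite sum_lfunE {1}(dual_sum f) linear_sum.
by apply: eq_bigr => i _; rewrite ptensE linearZ.
Qed.

Lemma tensor_ext U V W (f h : 'Hom(tensor U V, W)) :
  (forall u v, f (ptens u v) = h (ptens u v)) -> f = h.
Proof.
move=> fh; apply/lfunP=> t; rewrite (tensor_sum t).
rewrite [LHS]linear_sum [RHS]linear_sum.
by apply: eq_bigr => i _; apply: fh.
Qed.

(* The pairing of A (x) B with A^* (x) B^*. *)
Definition tpair U V (t : tensor U V) (a : dual U) (b : dual V) : F := b (t a).

Lemma tpairE U V (u : U) (v : V) a b :
  tpair (ptens u v) a b = (a u : F) * (b v : F).
Proof. by rewrite /tpair ptensE linearZ. Qed.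

Definition tmap U V U' V' (f : 'Hom(U, U')) (h : 'Hom(V, V')) :
    'Hom(tensor U V, tensor U' V') :=
  tlift (lfun2 (fun u v => ptens (f u) (h v))).

Definition tflip U V : 'Hom(tensor U V, tensor V U) :=
  tlift (lfun2 (fun u v => ptens v u)).

Definition tassoc U V W :
    'Hom(tensor (tensor U V) W, tensor U (tensor V W)) :=
  tlift (tlift (lfun2 (fun u v => linfun (fun w => ptens u (ptens v w))))).

Definition tassocV U V W :
    'Hom(tensor U (tensor V W), tensor (tensor U V) W) :=
  tlift (linfun (fun u => tlift (lfun2 (fun v w => ptens (ptens u v) w)))).

Lemma tmapE U V U' V' (f : 'Hom(U, U')) (h : 'Hom(V, V')) u v :
  tmap f h (ptens u v) = ptens (f u) (h v).
Proof.
rewrite /tmap tliftE lfun2E // => x a y z; rewrite linearP ?ptens_linearr //.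
exact: ptens_linearl.
Qed.

Lemma tflipE U V (u : U) (v : V) : tflip U V (ptens u v) = ptens v u.
Proof.
rewrite /tflip tliftE lfun2E // => x a y z;
  [exact: ptens_linearl | exact: ptens_linearr].
Qed.

Lemma tassocE U V W (u : U) (v : V) (w : W) :
  tassoc U V W (ptens (ptens u v) w) = ptens u (ptens v w).
Proof.
have lw (u1 : U) (v1 : V) : linear (fun w1 : W => ptens u1 (ptens v1 w1)).
  by move=> a y z; rewrite !ptens_linearr.
rewrite /tassoc !tliftE lfun2E ?linfunP // => x a y z; apply/lfunP=> t;
  rewrite add_lfunE scale_lfunE !linfunP //.
  by rewrite ptens_linearl ptens_linearr.
by rewrite ptens_linearl.
Qed.

Lemma tassocVE U V W (u : U) (v : V) (w : W) :
  tassocV U V W (ptens u (ptens v w)) = ptens (ptens u v) w.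
Proof.
have l2 (x : U) (y : V) (z : W) :
    lfun2 (fun v w => ptens (ptens x v) w) y z = ptens (ptens x y) z.
  rewrite lfun2E // => [s|s] a y1 z1; first exact: ptens_linearr.
  by rewrite ptens_linearr ptens_linearl.
rewrite /tassocV tliftE linfunP ?tliftE ?l2 // => a x y.
apply: tensor_ext => s t; rewrite add_lfunE scale_lfunE !tliftE !l2.
by rewrite !ptens_linearl.
Qed.

(* [is_linear_dual op theta]: theta : A -> A (x) A is the linear dual of the
   operation op on A^*; it exists and is unique by [linear_dual_exists] and
   [linear_dual_unique]. *)
Definition is_linear_dual V (op : binop (dual V))
    (theta : 'Hom(V, tensor V V)) : Prop :=
  forall (x : V) (a b : dual V), tpair (theta x) a b = op a b x.

Lemma linear_dual_exists V (op : binop (dual V)) :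
  exists theta, is_linear_dual op theta.
Proof.
pose th (x : V) (a : dual V) : V :=
  \sum_(i < \dim {:V}) (op a (cofun i) x : F) *: (vbasis {:V})`_i.
exists (lfun2 th) => x a b; rewrite /tpair lfun2E /th.
- rewrite linear_sum [b in RHS]dual_sum linear_sum sum_lfunE.
  apply: eq_bigr => i _ /=; rewrite [LHS]linearZ [in RHS]linearZ scale_lfunE.
  exact: mulrC.
- move=> u c y z; rewrite scaler_sumr -big_split; apply: eq_bigr => i _ /=.
  by rewrite linearP add_lfunE scale_lfunE add_lfunE scale_lfunE scalerDl scalerA.
move=> v c y z; rewrite scaler_sumr -big_split; apply: eq_bigr => i _ /=.
by rewrite linearP scalerDl scalerA.
Qed.

Lemma linear_dual_unique V (op : binop (dual V)) theta theta' :
  is_linear_dual op theta -> is_linear_dual op theta' -> theta = theta'.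
Proof.
move=> h h'; apply/lfunP=> x; apply/lfunP=> a.
rewrite (coord_vbasis (memvf (theta x a))) (coord_vbasis (memvf (theta' x a))).
apply: eq_bigr => i _; congr (_ *: _).
have := etrans (h x a (cofun i)) (esym (h' x a (cofun i))).
by rewrite /tpair !lfunE.
Qed.

End LinearMaps.

Notation "f ⊗ g" := (tmap f%VF g%VF) (at level 40, left associativity) : ring_scope.

Section Structures.

Variables (F : fieldType) (A : vectType F).
Implicit Types (br op tr tl : binop A) (P Q : 'End(A)).
Implicit Types d D N : 'Hom(A, tensor A A).

Local Notation tau := (tflip A A).
Local Notation assoc := (tassoc A A A).

(* tau (x) id transported to A (x) (A (x) A), see [tau12E]. *)
Definition tau12 : 'Hom(tensor A (tensor A A), tensor A (tensor A A)) :=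
  (assoc \o (tau ⊗ \1) \o tassocV A A A)%VF.

Lemma tau12E x y z : tau12 (ptens x (ptens y z)) = ptens y (ptens x z).
Proof. by rewrite /tau12 !comp_lfunE tassocVE tmapE tflipE id_lfunE tassocE. Qed.

(* ad(x), and more generally L_op(x), is [op x]; R_op(y) is [rmul op y]. *)
Definition is_lie br : Prop :=
  (forall x, br x x = 0) /\
  (forall x y z, br x (br y z) + br y (br z x) + br z (br x y) = 0).

Definition is_rb_lie br P : Prop :=
  is_lie br /\
  (forall x y, br (P x) (P y) = P (br x (P y)) + P (br (P x) y)).

Definition admissible br P Q : Prop :=
  forall x y, Q (br (P x) y) - br (P x) (Q y) - Q (br x (Q y)) = 0.

(* tr is the operation |>, tl is the operation <|. *)
Definition is_ldend tr tl : Prop :=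
  (forall x y z,
     tr (tr x y) z + tr (tl x y) z + tr y (tr x z)
     - tr (tl y x) z - tr (tr y x) z - tr x (tr y z) = 0) /\
  (forall x y z,
     tl (tr x y) z + tl y (tr x z) + tl y (tl x z)
     - tl (tl y x) z - tr x (tl y z) = 0).

Definition is_special_ldend tr tl : Prop :=
  is_ldend tr tl /\ (forall x y, tl x y = - tl y x).

(* Triple tensors are compared in A (x) (A (x) A). *)
Definition is_special_ldend_coalg D N : Prop :=
  let L := D + N in
  [/\ forall x, N x = - tau (N x),
      forall x,
        (\1 ⊗ N) (N x) + tau12 ((\1 ⊗ L) (N x))
        + assoc ((L ⊗ \1) (N x)) - (\1 ⊗ N) (L x) = 0
    & forall x,
        assoc ((L ⊗ \1) (L x)) - (\1 ⊗ L) (L x)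
        = tau12 (assoc ((L ⊗ \1) (L x))) - tau12 ((\1 ⊗ L) (L x))].

Definition is_special_ldend_bialg tr tl D N : Prop :=
  let L := D + N in
  let circ := tr + tl in
  let com x y := circ x y - circ y x in
  [/\ is_special_ldend tr tl,
      is_special_ldend_coalg D N,
      forall x y,
        L (circ x y) - (\1 ⊗ rmul circ y) (D x) + (tl y ⊗ \1) (N x)
        - (tr x ⊗ \1 + \1 ⊗ circ x) (L y) = 0,
      forall x y,
        (tau - \1%VF) ((\1 ⊗ tl x) (L y) - (\1 ⊗ tl y) (L x) - L (tl x y)) = 0
    & forall x y,
        N (com x y) + (circ y ⊗ \1 + \1 ⊗ circ y) (N x)
        - (circ x ⊗ \1 + \1 ⊗ circ x) (N y) = 0].

(* [cyc] is the cyclic permutation x (x) y (x) z |-> y (x) z (x) x. *)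
Definition is_lie_coalg d : Prop :=
  let cyc := ((\1 ⊗ tau) \o tau12)%VF in
  (forall x, d x = - tau (d x)) /\
  (forall x,
     let t := (\1 ⊗ d) (d x) in t + cyc t + cyc (cyc t) = 0).

Definition is_lie_bialg br d : Prop :=
  [/\ is_lie br, is_lie_coalg d
    & forall x y,
        d (br x y) = (br x ⊗ \1 + \1 ⊗ br x) (d y)
                     - (br y ⊗ \1 + \1 ⊗ br y) (d x)].

Definition is_rb_lie_bialg br P d Q : Prop :=
  [/\ is_lie_bialg br d,
      is_rb_lie br P,
      forall x, (Q ⊗ Q) (d x) = (Q ⊗ \1 + \1 ⊗ Q) (d (Q x)),
      admissible br P Q
    & forall x, (P ⊗ Q) (d x) + (P ⊗ \1 - \1 ⊗ Q) (d (P x)) = 0].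

Definition rb_prelie br P : binop A := lfun2 (fun x y => br (P x) y).

Definition rb_tl br Q : binop A := lfun2 (fun x y => - Q (br x y)).

Definition rb_tr br P Q : binop A := rb_prelie br P - rb_tl br Q.

Lemma rb_prelieE br P x y : rb_prelie br P x y = br (P x) y.
Proof.
rewrite /rb_prelie lfun2E // => u a v w; first exact: linearP.
by rewrite !linearP add_lfunE scale_lfunE.
Qed.

Lemma rb_tlE br Q x y : rb_tl br Q x y = - Q (br x y).
Proof.
rewrite /rb_tl lfun2E // => u a v w.
  by rewrite !linearP.
by rewrite linearP add_lfunE scale_lfunE !linearP.
Qed.

Lemma rb_trE br P Q x y : rb_tr br P Q x y = br (P x) y + Q (br x y).
Proof.
by rewrite /rb_tr !add_lfunE !opp_lfunE rb_prelieE rb_tlE opprK.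
Qed.

End Structures.

(* Main.v *)
(** Since [nabla = - delta P] and [Delta + nabla = (Q ⊗ 1) delta], each of the
    three compatibility equations of a special L-dendriform bialgebra turns,
    one at a time, into one of the three displayed equations: the first by
    admissibility of [Q] and [P^*], the second by antisymmetry of [delta] and
    the Rota-Baxter identity of [Q^*], the third by that of [P]. Admissibility
    also makes both operations special L-dendriform, and the coalgebra axioms
    are the dual identities paired with triples of functionals. *)
Require Import Defs.
From mathcomp Require Import all_boot all_order all_algebra.
From mathcomp Require Import ring.

Import GRing.Theory.
Local Open Scope ring_scope.

(** * Tensors as maps on dual spaces, evaluated at functionals *)

Section TensorEvaluation.

Set Implicit Arguments.

Variable F : fieldType.
Implicit Types U V W : vectType F.

Lemma lfunD U V (f : 'Hom(U, V)) x y : f (x + y) = f x + f y.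
Proof. exact: linearD. Qed.

Lemma lfunN U V (f : 'Hom(U, V)) x : f (- x) = - f x.
Proof. exact: linearN. Qed.

Definition lfun_additive := (lfunD, lfunN, add_lfunE, opp_lfunE).

Lemma dual_separates U (u v : U) : (forall a : dual U, a u = a v) -> u = v.
Proof.
move=> uv; rewrite (coord_vbasis (memvf u)) (coord_vbasis (memvf v)).
by apply: eq_bigr => i _; have := uv (cofun i); rewrite !lfunE => ->.
Qed.

(** Evaluation identities compare plain functions of a tensor; with linearity given as a
    proposition, they too can be checked on pure tensors. *)
Lemma tensor_ext_pure U V W (f h : tensor U V -> W) :
  linear f -> linear h -> (forall u v, f (ptens u v) = h (ptens u v)) ->
  f =1 h.
Proof.
move=> lf lh fh t; rewrite -(linfunP lf) -(linfunP lh).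
by congr (fun_of_lfun _ _); apply: tensor_ext => u v; rewrite !linfunP.
Qed.

(** A tensor is a map out of [dual U], so [h] acts after it, while [f] acts before it through its
    transpose. *)
Lemma tmap_lfunE U V U' V' (f : 'Hom(U, U')) (h : 'Hom(V, V')) t a :
  (f ⊗ h) t a = h (t (transpose f a)).
Proof.
move: t; apply: tensor_ext_pure => [c s t|c s t|u v].
- by rewrite linearP add_lfunE scale_lfunE.
- by rewrite add_lfunE scale_lfunE linearP.
by rewrite tmapE !ptensE linearZ transposeE.
Qed.

Lemma tpair_tflip U V (t : tensor U V) a b :
  tpair (tflip U V t) a b = tpair t b a.
Proof.
move: t; apply: (@tensor_ext_pure U V F^o) => [c s t|c s t|u v].
- by rewrite /tpair linearP add_lfunE scale_lfunE linearP.
- by rewrite /tpair add_lfunE scale_lfunE linearP.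
by rewrite tflipE !tpairE mulrC.
Qed.

Lemma tau12_lfunE V (t : tensor V (tensor V V)) a b : tau12 V t a b = t b a.
Proof.
move: t; apply: tensor_ext_pure => [c s t|c s t|u v].
- by rewrite linearP !(add_lfunE, scale_lfunE).
- by rewrite !(add_lfunE, scale_lfunE).
move: v; apply: tensor_ext_pure => [c s t|c s t|v w].
- by rewrite ptens_linearr linearP !(add_lfunE, scale_lfunE).
- by rewrite ptens_linearr !(add_lfunE, scale_lfunE).
rewrite tau12E !ptensE !scale_lfunE !ptensE !scalerA; congr (_ *: _).
exact: mulrC.
Qed.

(** Evaluating an element of (U ⊗ V) ⊗ W takes a single functional on U ⊗ V; this is the one given
    by a ⊗ b. *)
Definition dual_tens U V (a : dual U) (b : dual V) : dual (tensor U V) :=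
  linfun (fun t : tensor U V => tpair t a b : F^o).

Lemma dual_tensE U V (a : dual U) (b : dual V) t :
  dual_tens a b t = tpair t a b.
Proof.
rewrite /dual_tens linfunP // => c s u.
by rewrite /tpair add_lfunE scale_lfunE linearP.
Qed.

Lemma tassoc_lfunE U V W (t : tensor (tensor U V) W) a b :
  tassoc U V W t a b = t (dual_tens a b).
Proof.
move: t; apply: tensor_ext_pure => [c s t|c s t|u w].
- by rewrite linearP !(add_lfunE, scale_lfunE).
- by rewrite !(add_lfunE, scale_lfunE).
move: u; apply: tensor_ext_pure => [c s t|c s t|u v].
- by rewrite ptens_linearl linearP !(add_lfunE, scale_lfunE).
- by rewrite ptens_linearl !(add_lfunE, scale_lfunE).
by rewrite tassocE !ptensE scale_lfunE !ptensE dual_tensE tpairE scalerA.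
Qed.

Lemma transpose_linear_dual V (op : binop (dual V)) theta a b :
  is_linear_dual op theta -> transpose theta (dual_tens a b) = op a b.
Proof. by move=> h; apply/lfunP=> x; rewrite transposeE dual_tensE h. Qed.

Lemma transpose_id V (a : dual V) : transpose \1%VF a = a.
Proof. by apply/lfunP=> x; rewrite transposeE id_lfunE. Qed.

End TensorEvaluation.

(** * Special L-dendriform algebras from admissible Rota-Baxter Lie algebras *)

Section RotaBaxterLDendriform.

Set Implicit Arguments.

Variables (F : fieldType) (V : vectType F).
Variables (br : binop V) (P Q : 'End(V)).
Hypothesis lie : is_lie br.

Lemma lie_anti x y : br x y = - br y x.
Proof.
have [alt _] := lie; have /eqP := alt (x + y).
by rewrite !lfun_additive !alt add0r addr0 addrC addr_eq0 => /eqP.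
Qed.

Lemma lie_jacobi x y z : br (br x y) z = br x (br y z) - br y (br x z).
Proof.
have [_ /(_ x y z)/eqP] := lie.
rewrite (lie_anti z (br x y)) subr_eq0 => /eqP <-.
by rewrite (lie_anti z x) lfunN.
Qed.

Lemma rb_circE x y : (rb_tr br P Q + rb_tl br Q) x y = br (P x) y.
Proof. by rewrite 2!add_lfunE rb_trE rb_tlE addrK. Qed.

(** Admissibility moves [Q] outside each bracket [br (P x) (Q y)]; Jacobi then normalizes the nested
    brackets and the terms cancel. *)
Lemma rb_special_ldend :
    is_rb_lie br P -> admissible br P Q ->
  is_special_ldend (rb_tr br P Q) (rb_tl br Q).
Proof.
move=> rbP adm.
have admE x y : br (P x) (Q y) = Q (br (P x) y) - Q (br x (Q y)).
  by apply/eqP; rewrite eq_sym -subr_eq0 addrAC; apply/eqP/adm.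
split=> [|x y]; last by rewrite !rb_tlE (lie_anti x y) lfunN.
(* Testing against a functional turns a vector identity into a scalar one, within reach of
   [ring]. *)
split=> x y z; apply: dual_separates => a.
  rewrite !(rb_trE, rb_tlE, lfun_additive) !admE.
  (* The Rota-Baxter identity trades one of the two terms P[Px,y], P[Py,x] for the other, so that
     they cancel. *)
  have P1 : P (br (P x) y) = br (P x) (P y) + P (br (P y) x).
    by rewrite (proj2 rbP) (lie_anti (P y)) lfunN addrAC subrr add0r.
  rewrite P1 !lfun_additive !lie_jacobi !lfun_additive linear0.
  ring.
rewrite !(rb_trE, rb_tlE, lfun_additive) !admE !lie_jacobi.
rewrite (lie_anti y x) ?(lie_anti y (br x z)) !lfun_additive linear0.
ring.
Qed.

End RotaBaxterLDendriform.

(** * Dualizing the L-dendriform axioms to coalgebra axioms *)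

Section LDendriformCoalgebra.

Set Implicit Arguments.

Variables (F : fieldType) (V : vectType F).
Implicit Types (op tr tl : binop (dual V)) (D N T : 'Hom(V, tensor V V)).
Implicit Types a b c : dual V.

Lemma tpair_ext (t s : tensor V V) :
  (forall a b, tpair t a b = tpair s a b) -> t = s.
Proof. by move=> ts; apply/lfunP=> a; apply: dual_separates => b; apply: ts. Qed.

Lemma tpair3_ext (t s : tensor V (tensor V V)) :
  (forall a b c, tpair (t a) b c = tpair (s a) b c) -> t = s.
Proof. by move=> ts; apply/lfunP=> a; apply: tpair_ext; apply: ts. Qed.

(** With the next two lemmas, a dictionary: a coproduct on one leg becomes the product of the two
    functionals it meets, and [tau12] swaps the first two functionals. *)
Lemma tpair3_id_dual op T t a b c :
  is_linear_dual op T -> tpair ((\1 ⊗ T) t a) b c = tpair t a (op b c).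
Proof. by move=> h; rewrite tmap_lfunE transpose_id h. Qed.

Lemma tpair3_dual_id op T t a b c :
    is_linear_dual op T ->
  tpair (tassoc V V V ((T ⊗ \1) t) a) b c = tpair t (op a b) c.
Proof.
move=> h; rewrite /tpair tassoc_lfunE tmap_lfunE id_lfunE.
by rewrite (transpose_linear_dual _ _ h).
Qed.

Lemma tpair3_tau12 (t : tensor V (tensor V V)) a b c :
  tpair (tau12 V t a) b c = tpair (t b) a c.
Proof. by rewrite /tpair tau12_lfunE. Qed.

Lemma tpairD (t s : tensor V V) a b :
  tpair (t + s) a b = tpair t a b + tpair s a b.
Proof. by rewrite /tpair !lfun_additive. Qed.

Lemma tpairN (t : tensor V V) a b : tpair (- t) a b = - tpair t a b.
Proof. by rewrite /tpair !lfun_additive. Qed.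

Lemma special_ldend_coalg tr tl D N :
    is_linear_dual tr D -> is_linear_dual tl N -> is_special_ldend tr tl ->
  is_special_ldend_coalg D N.
Proof.
move=> hD hN [[ax1 ax2] anti].
have hL : is_linear_dual (tr + tl) (D + N).
  by move=> x a b; rewrite add_lfunE tpairD hD hN !add_lfunE.
split=> x.
- by apply: tpair_ext => a b; rewrite tpairN tpair_tflip !hN anti opp_lfunE.
- apply: tpair3_ext => a b c.
  rewrite !(add_lfunE, opp_lfunE, tpairD, tpairN) tpair3_tau12.
  rewrite !(tpair3_id_dual _ _ _ _ hN) (tpair3_id_dual _ _ _ _ hL).
  rewrite (tpair3_dual_id _ _ _ _ hL) tpairD !hN hD /tpair !zero_lfunE linear0.
  have /lfunP/(_ x) := ax2 a b c.
  rewrite (anti b a) !lfun_additive zero_lfunE => <-.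
  ring.
apply: tpair3_ext => a b c.
rewrite !(add_lfunE, opp_lfunE, tpairD, tpairN) !tpair3_tau12.
rewrite !(tpair3_id_dual _ _ _ _ hL) !(tpair3_dual_id _ _ _ _ hL).
rewrite !tpairD !hN !hD.
(* The goal is the pre-Lie identity of [tr + tl]: the first axiom at (a,b,c), plus the second at
   (a,b,c), minus the second at (b,a,c). *)
have /lfunP/(_ x) := ax1 a b c; rewrite !lfun_additive zero_lfunE => e1.
have /lfunP/(_ x) := ax2 a b c; rewrite !lfun_additive zero_lfunE => e2.
have /lfunP/(_ x) := ax2 b a c; rewrite !lfun_additive zero_lfunE => e3.
rewrite (anti a b) !lfun_additive in e1 e3 |- *.
apply/eqP; rewrite -subr_eq0; apply/eqP.
have := congr2 (fun u v => u - v) (congr2 +%R e1 e2) e3.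
rewrite /= addr0 subr0 => <-; ring.
Qed.

End LDendriformCoalgebra.

(** * The three compatibility equations in terms of [delta] *)

Section Compatibility.

Set Implicit Arguments.

Variables (F : fieldType) (g : vectType F).
Variables (br : binop g) (brs : binop (dual g)) (P Q : 'End(g)).
Variables delta Delta nabla : 'Hom(g, tensor g g).
Hypothesis lie : is_lie br.
Hypothesis rbQ : is_rb_lie brs (transpose Q).
Hypothesis rbP : is_rb_lie br P.
Hypothesis admQ : admissible br P Q.
Hypothesis admP : admissible brs (transpose Q) (transpose P).
Hypothesis hdelta : is_linear_dual brs delta.
Hypothesis hDelta :
  is_linear_dual (rb_tr brs (transpose Q) (transpose P)) Delta.
Hypothesis hnabla : is_linear_dual (rb_tl brs (transpose P)) nabla.

Lemma dual_deltaE x (a b : dual g) : b (delta x a) = brs a b x.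
Proof. exact: hdelta. Qed.

Lemma nablaE x : nabla x = - delta (P x).
Proof.
apply: tpair_ext => a b.
by rewrite tpairN hnabla rb_tlE opp_lfunE transposeE hdelta.
Qed.

Lemma Delta_lfunE x a : Delta x a = delta x (transpose Q a) + delta (P x) a.
Proof.
apply: dual_separates => b; rewrite lfunD -![fun_of_lfun b _]/(tpair _ _ _).
by rewrite hDelta rb_trE add_lfunE transposeE -!hdelta.
Qed.

Lemma DiamondE x : (Delta + nabla) x = (Q ⊗ \1) (delta x).
Proof.
apply/lfunP=> a; rewrite !add_lfunE Delta_lfunE nablaE opp_lfunE addrK.
by rewrite tmap_lfunE id_lfunE.
Qed.

Lemma delta_anti x a b : tpair (delta x) a b = - tpair (delta x) b a.
Proof. by rewrite !hdelta (lie_anti rbQ.1) opp_lfunE. Qed.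

Lemma delta_anti_lfun x (a b : dual g) : b (delta x a) = - a (delta x b).
Proof. exact: delta_anti. Qed.

(** Admissibility of [transpose P] with its second functional stripped off; the right side is
    [P (Delta x a)]. *)
Lemma admP_delta x a :
  delta (P x) (transpose Q a) = P (delta x (transpose Q a)) + P (delta (P x) a).
Proof.
apply: dual_separates => b; rewrite lfunD -!(transposeE P b) !dual_deltaE.
have /lfunP/(_ x) := admP a b; rewrite !lfun_additive zero_lfunE !transposeE.
move=> /eqP; rewrite -addrA -opprD subr_eq0 => /eqP ->.
by [].
Qed.

Lemma transpose_rb_tl y a :
  transpose (rb_tl br Q y) a = - transpose (br y) (transpose Q a).
Proof. by apply/lfunP=> z; rewrite opp_lfunE !transposeE rb_tlE lfunN. Qed.

(** Transposed form of L_▷(x) Q = Q ad(P x), which is admissibility of [Q]; it lets L_▷(x) ⊗ id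
    slide past Q ⊗ id. *)
Lemma transpose_rb_tr x a :
  transpose Q (transpose (rb_tr br P Q x) a)
  = transpose (br (P x)) (transpose Q a).
Proof.
apply/lfunP=> z; rewrite !transposeE rb_trE.
have /eqP := admQ x z; rewrite -addrA -opprD subr_eq0 => /eqP ->.
by [].
Qed.

Lemma bialg1E x y :
  let tr := rb_tr br P Q in let tl := rb_tl br Q in let L := Delta + nabla in
  let circ := tr + tl in
  L (circ x y) - (\1 ⊗ rmul circ y) (Delta x) + (tl y ⊗ \1) (nabla x)
    - (tr x ⊗ \1 + \1 ⊗ circ x) (L y)
  = (Q ⊗ \1) (delta (br (P x) y)
              + (\1 ⊗ br y + br y ⊗ \1) (delta (P x))
              - (\1 ⊗ br (P x) + br (P x) ⊗ \1) (delta y)).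
Proof.
move=> tr tl L circ; rewrite {}/L !DiamondE nablaE.
have circE u v : circ u v = br (P u) v by apply: rb_circE.
have tlE := transpose_rb_tl; have trE := transpose_rb_tr.
rewrite -/tl -/tr in tlE trE; clearbody circ tr tl; apply/lfunP=> a.
rewrite !(add_lfunE, opp_lfunE, tmap_lfunE, lfunD, lfunN, id_lfunE).
rewrite !rmulE !circE Delta_lfunE !transpose_id tlE trE !lfun_additive opprK.
(* The term with [rmul circ y] involves [P (Delta x a)], so it matches (Q ⊗ ad(y)) δ(P x) up to the
   sign from swapping the bracket. *)
rewrite admP_delta !lfun_additive (lie_anti lie (P (delta x _))).
rewrite (lie_anti lie (P (delta (P x) a))).
apply: dual_separates => b; rewrite !lfun_additive; ring.
Qed.

(** By antisymmetry of δ, the flip supplies the ad ⊗ id terms missing on the left, and for z = [x,y]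
    it produces (Q ⊗ id + id ⊗ Q) δ(Q z), which is (Q ⊗ Q) δ(z) by Rota-Baxter for [transpose Q]. *)
Lemma bialg2E x y a b :
  let tl := rb_tl br Q in let L := Delta + nabla in
  tpair ((tflip g g - \1%VF)
    ((\1 ⊗ tl x) (L y) - (\1 ⊗ tl y) (L x) - L (tl x y))) a b
  = - tpair ((Q ⊗ Q) (delta (br x y)
                  + (\1 ⊗ br y + br y ⊗ \1) (delta x)
                  - (\1 ⊗ br x + br x ⊗ \1) (delta y))) a b.
Proof.
move=> tl L; rewrite {}/L !DiamondE rb_tlE.
rewrite add_lfunE opp_lfunE id_lfunE tpairD tpairN tpair_tflip.
rewrite /tpair !(add_lfunE, opp_lfunE, tmap_lfunE, lfunD, lfunN, id_lfunE).
rewrite !rb_tlE !transpose_id !lfunN.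
(* Antisymmetry of δ carries [br u] from one leg to the other. *)
have anti_br u v : a (Q (br u (delta v (transpose Q b))))
    = - b (Q (delta v (transpose (br u) (transpose Q a)))).
  by rewrite -(transposeE Q b) delta_anti_lfun opprK !transposeE.
rewrite !anti_br -(transposeE Q b (delta (br x y) _)) !dual_deltaE rbQ.2.
rewrite (lie_anti rbQ.1 (transpose Q b)) !(add_lfunE, opp_lfunE, transposeE).
ring.
Qed.

Lemma bialg3E x y :
  let circ := rb_tr br P Q + rb_tl br Q in
  let com u v := circ u v - circ v u in
  nabla (com x y) + (circ y ⊗ \1 + \1 ⊗ circ y) (nabla x)
    - (circ x ⊗ \1 + \1 ⊗ circ x) (nabla y)
  = (\1 ⊗ br (P x) + br (P x) ⊗ \1) (delta (P y))
    - (\1 ⊗ br (P y) + br (P y) ⊗ \1) (delta (P x)) - delta (br (P x) (P y)).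
Proof.
move=> circ; have circE u : circ u = br (P u).
  by apply/lfunP=> v; apply: rb_circE.
(* Rota-Baxter says that [P] sends [Px,y] - [Py,x] to [Px,Py]. *)
move=> com; have -> : nabla (com x y) = - delta (br (P x) (P y)).
  by rewrite nablaE /com !circE (lie_anti lie (P y)) opprK lfunD rbP.2 addrC.
rewrite !circE !nablaE !lfunN opprK !add_lfunE.
apply: tpair_ext => a b; rewrite !(tpairD, tpairN); ring.
Qed.

End Compatibility.

Theorem proposition3p23 (F : fieldType) (charF : [pchar F] =i pred0)
  (g : vectType F)
  (br : binop g) (brs : binop (dual g))
  (P Q : 'End(g))
  (rbP : is_rb_lie br P)
  (rbQ : is_rb_lie brs (transpose Q))
  (admQ : admissible br P Q)
  (admP : admissible brs (transpose Q) (transpose P))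
  (delta Delta nabla : 'Hom(g, tensor g g))
  (hdelta : is_linear_dual brs delta)
  (hDelta : is_linear_dual (rb_tr brs (transpose Q) (transpose P)) Delta)
  (hnabla : is_linear_dual (rb_tl brs (transpose P)) nabla) :
  (is_special_ldend_bialg (rb_tr br P Q) (rb_tl br Q) Delta nabla <->
   [/\ forall x y : g,
         (Q ⊗ \1) (delta (br (P x) y)
                   + (\1 ⊗ br y + br y ⊗ \1) (delta (P x))
                   - (\1 ⊗ br (P x) + br (P x) ⊗ \1) (delta y)) = 0,
       forall x y : g,
         (Q ⊗ Q) (delta (br x y)
                  + (\1 ⊗ br y + br y ⊗ \1) (delta x)
                  - (\1 ⊗ br x + br x ⊗ \1) (delta y)) = 0
     & forall x y : g,
         delta (br (P x) (P y))
         = (\1 ⊗ br (P x) + br (P x) ⊗ \1) (delta (P y))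
           - (\1 ⊗ br (P y) + br (P y) ⊗ \1) (delta (P x))]) /\
  (is_rb_lie_bialg br P delta Q ->
   is_special_ldend_bialg (rb_tr br P Q) (rb_tl br Q) Delta nabla).
Proof.
have lie := rbP.1.
have special_alg := rb_special_ldend rbP.1 rbP admQ.
(* The dual data satisfy the same hypotheses, with [transpose Q] in the role of [P] and
   [transpose P] in that of [Q]. *)
have special_coalg : is_special_ldend_coalg Delta nabla.
  exact: special_ldend_coalg hDelta hnabla (rb_special_ldend rbQ.1 rbQ admP).
have E1 := bialg1E lie admQ admP hdelta hDelta hnabla.
have E2 := bialg2E br P Q rbQ hdelta hDelta hnabla.
have E3 := bialg3E Q lie rbP hdelta hnabla.
set conds := [/\ _, _ & _].
have bialg_iff : is_special_ldend_bialg (rb_tr br P Q) (rb_tl br Q) Delta nabla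
    <-> conds.
  split=> [[_ _ b1 b2 b3] | [c1 c2 c3]].
    split=> x y; first by rewrite -E1 b1.
      apply: tpair_ext => a b; apply: oppr_inj; rewrite -E2 b2.
      by rewrite -tpairN oppr0.
    by apply/esym/eqP; rewrite -subr_eq0 -E3 b3.
  split=> // x y; first by rewrite E1 c1.
    by apply: tpair_ext => a b; rewrite E2 c2 -tpairN oppr0.
  by rewrite E3 c3 subrr.
split=> // -[[_ _ cocycle] _ _ _ _].
(* The cocycle condition annihilates the argument of Q ⊗ id and of Q ⊗ Q; the third equation is its
   instance at P x, P y. *)
have cocycle0 x y : delta (br x y) + (\1 ⊗ br y + br y ⊗ \1) (delta x)
    - (\1 ⊗ br x + br x ⊗ \1) (delta y) = 0.
  by rewrite cocycle ![\1 ⊗ _ + _]addrC subrK subrr.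
apply/bialg_iff; split=> x y; rewrite ?cocycle0 ?linear0 //.
by rewrite cocycle ![\1 ⊗ _ + _]addrC.
Qed.
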